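(* Let $I$ be a monomial ideal in a polynomial ring $R$ over a field. Let $b_0,b_1$ be distinct variables of $R$ such that: (1) no minimal monomial generator of $I$ is divisible by $b_0^2$ or by $b_1^2$; (2) every minimal monomial generator of $I$ that is divisible by $b_0$ is also divisible by $b_1$. Suppose that there do not exist variables $c,d$ of $R$, not necessarily distinct, such that all three of $b_1c$, $b_1d$, $cd$ divide minimal monomial generators of $I$. Then $b_0+b_1$ is regular on $R/I^2$.
   Context: Each of $b_1c$, $b_1d$, $cd$ ''divides minimal generators of $I$'' means each divides some minimal monomial generator of $I$ (possibly different generators for different products). An element $f$ is regular on $R/J$ if it is a nonzerodivisor on $R/J$ and $R/(J,f)\neq 0$.
   Formalization: The monomial ideal I is assumed proper: for I = R all the hypotheses hold (the only minimal generator is 1), but R/(I^2, b_0+b_1) = 0, so b_0+b_1 is not regular in the stated sense. *)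

(* Defs.v *)
From HB Require Import structures.
From mathcomp Require Import all_boot all_order all_algebra.
From mathcomp Require Import mpoly.

Set Implicit Arguments.
Unset Strict Implicit.
Unset Printing Implicit Defensive.

Import GRing.Theory.
Local Open Scope ring_scope.

(* Ideals are Prop-valued subsets of the ring: the ideals of ring_quotient are
   boolean predicates and have no generation, sum or product. *)
Section Ideals.
Variable R : comNzRingType.
Implicit Types (S I J : R -> Prop) (f g : R).

Definition ideal_gen S : R -> Prop := fun f =>
  exists k (a s : 'I_k -> R),
    (forall i, S (s i)) /\ f = \sum_(i < k) a i * s i.

Definition ideal_mul I J : R -> Prop :=
  ideal_gen (fun h => exists f g, [/\ I f, J g & h = f * g]).

Definition ideal_adjoin J f : R -> Prop := ideal_gen (fun g => J g \/ g = f).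

(* The first conjunct says that the class of f is a nonzerodivisor in R/J, the
   second that R/(J,f) is not the zero ring. *)
Definition regular_mod J f : Prop :=
  (forall g, J (f * g) -> J g) /\ ~ ideal_adjoin J f 1.

End Ideals.

Section MonomialIdeals.
Variables (n : nat) (K : fieldType).
Implicit Types (I : {mpoly K[n]} -> Prop) (G : 'X_{1..n} -> Prop).

(* A monomial 'X_[m] is represented by its exponent vector m, and divisibility
   of monomials is the componentwise order (_ <= _)%MM. *)
Definition mon_generates G I : Prop :=
  forall f, I f <-> ideal_gen (fun g => exists2 m, G m & g = 'X_[m]) f.

Definition monomial_ideal I : Prop := exists G, mon_generates G I.

Definition min_mon_generates G I : Prop :=
  mon_generates G I /\
  forall G', (forall m, G' m -> G m) -> mon_generates G' I ->
             forall m, G m -> G' m.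

(* The minimal set of monomial generators of a monomial ideal exists and is
   unique, so the existential below is only a way to refer to it. *)
Definition min_generator I (m : 'X_{1..n}) : Prop :=
  exists2 G, min_mon_generates G I & G m.

Definition divides_min_generator I (u : 'X_{1..n}) : Prop :=
  exists2 m, min_generator I m & (u <= m)%MM.

End MonomialIdeals.

(* Main.v *)
Require Import Defs.
From mathcomp Require Import all_boot all_order all_algebra.
From mathcomp Require Import mpoly zify.
From Stdlib Require Import Classical.

Local Open Scope ring_scope.
Import GRing.Theory.

(** Membership of a polynomial in a monomial ideal is decided monomial by
    monomial, so the theorem reduces to exponent vectors. Write $J = I^2$ and
    call $u$ a monomial of $J$ when it is divisible by a product of two minimal
    generators of $I$ ([ideal_mul_msupp]).

    The heart of the proof is [square_colon]: a monomial $u$ with $u b_0 \in J$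
    and $u b_1 \in J$ already lies in $J$. In other words, no associated prime
    of $J$, being of the form $(J : u)$, contains both $b_0$ and $b_1$. Suppose
    $u \notin J$, let $m_1 m_2$ divide $u b_0$ and $m_3 m_4$ divide $u b_1$. As
    $u$ is too small in $b_0$ for $m_1 m_2$ and too small in $b_1$ for
    $m_3 m_4$, and every generator satisfies
    $\deg_{b_0} \le \deg_{b_1} \le 1$, counting degrees leaves one case: $u$
    has degree 0 in $b_0$ and 1 in $b_1$, one of $m_1, m_2$, say $m_1$, is
    divisible by $b_0 b_1$ while $m_2$ involves neither, and both $m_3$ and
    $m_4$ are divisible by $b_1$. Now $m_2 m_3$ does not divide $u$, so some
    variable $c$ is in excess there; it divides $m_2$ and $m_3$. Likewise some
    $d$ divides $m_2$ and $m_4$. Then $b_1 c$ divides $m_3$, $b_1 d$ divides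
    $m_4$, and $c d$ divides $m_2$. This holds for $c = d$ too: the exponent of
    $c$ in $m_2$ then exceeds that in $m_4$, which exceeds that in $m_1$, so it
    is at least 2. This is the forbidden configuration.

    To pass from monomials to polynomials, let $(b_0 + b_1) g \in J$. For every
    $N$, $b_0 + b_1$ divides $b_0^N - (-b_1)^N$. With $N$ beyond the degree of
    $g$, the terms of $b_0^N g$ and of $b_1^N g$ cannot cancel, so
    $u b_0^N \in J$ and, by symmetry, $u b_1^N \in J$ for each monomial $u$ of
    $g$ ([add_var_power_msupp]). The colon property, iterated in
    [colon_saturation], gives $u \in J$. Finally $(J, b_0 + b_1)$ is a proper
    ideal because none of its elements has a constant term. *)

(** * Monomial ideals and their supports *)

Lemma mem_ideal_gen (R : comNzRingType) (S : R -> Prop) (a s : R) :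
  S s -> ideal_gen S (a * s).
Proof.
move=> Ss; exists 1%N, (fun=> a), (fun=> s).
by split=> //; rewrite big_ord1.
Qed.

Lemma ideal_gen_add (R : comNzRingType) (S : R -> Prop) (f g : R) :
  ideal_gen S f -> ideal_gen S g -> ideal_gen S (f + g).
Proof.
move=> [k [a [s [Ss ->]]]] [l [b [t [St ->]]]].
pose glue (p : 'I_k -> R) (q : 'I_l -> R) i :=
  match split i with inl j => p j | inr j => q j end.
exists (k + l)%N, (glue a b), (glue s t); split.
  by move=> i; rewrite /glue; case: (split i).
rewrite big_split_ord; congr (_ + _); apply: eq_bigr => i _; rewrite /glue.
  by rewrite (unsplitK (inl i)).
by rewrite (unsplitK (inr i)).
Qed.

Definition above {n : nat} (G : 'X_{1..n} -> Prop) (u : 'X_{1..n}) : Prop :=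
  exists2 m, G m & (m <= u)%MM.

Lemma lepm_add {n : nat} {m1 m2 u1 u2 : 'X_{1..n}} :
  (m1 <= u1)%MM -> (m2 <= u2)%MM -> (m1 + m2 <= u1 + u2)%MM.
Proof.
move=> /mnm_lepP le1 /mnm_lepP le2; apply/mnm_lepP => i.
by rewrite !mnmDE leq_add.
Qed.

Lemma above_trans {n : nat} {G : 'X_{1..n} -> Prop} (u : 'X_{1..n}) {v : 'X_{1..n}} :
  above G u -> (u <= v)%MM -> above G v.
Proof. by move=> [m Gm mu] uv; exists m => //; apply: lepm_trans uv. Qed.

Lemma mem_msupp_mulr {n : nat} {K : fieldType} (a f : {mpoly K[n]}) u :
  u \in msupp (a * f) -> exists2 v, v \in msupp f & (v <= u)%MM.
Proof.
move/msuppM_le/allpairsP => [[v w] /= [_ wf ->]].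
by exists w => //; apply: lem_addl.
Qed.

(** Multiplication only pushes exponents up, and a monomial of a sum comes from
    one of the summands; hence a divisibility property of the generators passes
    to the whole ideal. *)
Lemma msupp_ideal_gen {n : nat} {K : fieldType} (S : {mpoly K[n]} -> Prop)
    (G : 'X_{1..n} -> Prop) (f : {mpoly K[n]}) :
  (forall s v, S s -> v \in msupp s -> above G v) ->
  ideal_gen S f -> forall u, u \in msupp f -> above G u.
Proof.
move=> SG [k [a [s [Ss ->]]]] u.
move/msupp_sum_le/flatten_mapP => [i _ /mem_msupp_mulr [v vs vu]].
exact: above_trans _ (SG _ _ (Ss i) vs) vu.
Qed.

Lemma ideal_gen_msupp {n : nat} {K : fieldType} (S : {mpoly K[n]} -> Prop)
    (f : {mpoly K[n]}) :
  (forall u, u \in msupp f ->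
     exists2 m, S 'X_[m] & (m <= u)%MM) ->
  ideal_gen S f.
Proof.
move=> fS; rewrite [f]mpolyE big_seq.
apply: big_ind => [||u uf].
- by exists 0%N, (fun=> 0), (fun=> 0); split=> [[]|] //; rewrite big_ord0.
- exact: ideal_gen_add.
- have [m Sm mu] := fS u uf.
  rewrite -(submK mu) mpolyXD scalerAl; exact: mem_ideal_gen.
Qed.

(** A monomial ideal contains exactly the polynomials all of whose monomials it
    contains; everything below works with supports through this criterion. *)
Lemma mon_generatesP {n : nat} {K : fieldType} (I : {mpoly K[n]} -> Prop)
    (G : 'X_{1..n} -> Prop) :
  mon_generates G I <->
  forall f, I f <-> forall u, u \in msupp f -> above G u.
Proof.
have gen (f : {mpoly K[n]}) : ideal_gen (fun g => exists2 m, G m & g = 'X_[m]) f <->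
    forall u, u \in msupp f -> above G u.
  split; last first.
    by move=> fG; apply: ideal_gen_msupp => u /fG [m Gm mu]; exists m => //; exists m.
  apply: msupp_ideal_gen => _ v [m Gm ->].
  by rewrite msuppX inE => /eqP ->; exists m => //; apply: lepm_refl.
by split=> H f; rewrite (H f) ?gen // -gen.
Qed.

Lemma mon_generates_mpolyX {n : nat} {K : fieldType} (I : {mpoly K[n]} -> Prop)
    (G : 'X_{1..n} -> Prop) (u : 'X_{1..n}) :
  mon_generates G I -> I 'X_[u] <-> above G u.
Proof.
move/mon_generatesP => ->; split=> [H|Gu v].
  by apply: H; rewrite msuppX inE.
by rewrite msuppX inE => /eqP ->.
Qed.

(** The monomials of [I] that are minimal for divisibility form a generating
    set by induction on the degree, and every monomial generating set drawn from
    them must contain each of them. So they are minimal generators, and each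
    monomial of [I] is a multiple of one. *)
Lemma above_min_generator {n : nat} {K : fieldType} (I : {mpoly K[n]} -> Prop) u :
  monomial_ideal I -> I 'X_[u] <-> above (min_generator I) u.
Proof.
move=> [G0 GI].
have IX v := mon_generates_mpolyX _ _ v GI.
pose M m := I 'X_[m] /\ forall m', I 'X_[m'] -> (m' <= m)%MM -> m' = m.
have aboveM v : I 'X_[v] <-> above M v.
  split; last first.
    by case=> m [/IX Im _] mv; apply/IX; apply: above_trans mv.
  elim: {v}(mdeg v).+1 {-2}v (ltnSn (mdeg v)) => // d IHd v; rewrite ltnS => vd Iv.
  case: (classic (exists2 w, I 'X_[w] & (w <= v)%MM /\ w <> v)).
    move=> [w Iw [wv neq]].
    apply: (above_trans w) => //; apply: IHd => //.
    apply: leq_trans vd; rewrite -(submK wv) mdegD -{1}[mdeg w]add0n ltn_add2r.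
    rewrite lt0n mdeg_eq0; apply/eqP => vw0; apply: neq.
    by rewrite -[RHS](submK wv) vw0 add0m.
  move=> nw; exists v; last exact: lepm_refl.
  by split=> // m' Im' le_m'v; apply: NNPP => neq; apply: nw; exists m'.
have genM : mon_generates M I.
  apply/mon_generatesP => f; rewrite (iffLR (mon_generatesP _ _) GI f).
  by split=> H v /H; rewrite -aboveM -IX.
have minM m : M m -> min_generator I m.
  move=> Mm; exists M => //; split=> // G' G'M genG' p [Ip minp].
  have [q G'q qp] := iffLR (mon_generates_mpolyX _ _ p genG') Ip.
  by rewrite -(minp q) //; have [] := G'M q G'q.
split; first by move/aboveM => [m Mm mu]; exists m => //; apply: minM.
move=> [m [G [genG _] Gm] mu].
by apply/(mon_generates_mpolyX _ _ _ genG); exists m.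
Qed.

Definition sum_of_two {n : nat} (M : 'X_{1..n} -> Prop) (m : 'X_{1..n}) : Prop :=
  exists m1 m2, [/\ M m1, M m2 & m = (m1 + m2)%MM].

Lemma ideal_mul_msupp {n : nat} {K : fieldType} (I : {mpoly K[n]} -> Prop) f :
  monomial_ideal I ->
  ideal_mul I I f <->
  forall u, u \in msupp f -> above (sum_of_two (min_generator I)) u.
Proof.
move=> monI; have [G GI] := monI.
have IX u : I 'X_[u] <-> above (min_generator I) u by apply: above_min_generator.
have supp g u : I g -> u \in msupp g -> above (min_generator I) u.
  move=> Ig ug; apply/IX/(mon_generates_mpolyX _ _ _ GI).
  exact: (iffLR (iffLR (mon_generatesP _ _) GI g)).
split.
  apply: msupp_ideal_gen => _ v [p [q [Ip Iq ->]]].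
  move/msuppM_le/allpairsP => [[v1 v2] /= [v1p v2q ->]].
  have [m1 M1 le1] := supp _ _ Ip v1p; have [m2 M2 le2] := supp _ _ Iq v2q.
  by exists (m1 + m2)%MM; [exists m1, m2 | apply: lepm_add].
move=> fM; apply: ideal_gen_msupp => u /fM [_ [m1 [m2 [M1 M2 ->]]] mu].
exists (m1 + m2)%MM => //; exists 'X_[m1], 'X_[m2].
by rewrite mpolyXD; split=> //; apply/IX; [exists m1|exists m2] => //; apply: lepm_refl.
Qed.

(** * The colon property of the square *)

(** If [u] were not above a sum of two elements of [M], degrees in [b0] and [b1]
    would determine how the given sums [m1 + m2] and [m3 + m4] meet these two
    variables. The variables where [m2 + m3 <= u] and [m2 + m4 <= u] fail are
    then a forbidden pair [c], [d]. *)
Lemma square_colon {n : nat} (M : 'X_{1..n} -> Prop) (b0 b1 : 'I_n) u :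
  b0 <> b1 ->
  (forall m, M m -> (m b0 <= m b1 <= 1)%N) ->
  (forall c d p q r, M p -> M q -> M r -> (U_(b1) + U_(c) <= p)%MM ->
     (U_(b1) + U_(d) <= q)%MM -> ~~ (U_(c) + U_(d) <= r)%MM) ->
  above (sum_of_two M) (u + U_(b0))%MM ->
  above (sum_of_two M) (u + U_(b1))%MM ->
  above (sum_of_two M) u.
Proof.
move=> b01 Mb nocd [_ [m1 [m2 [M1 M2 ->]]] /mnm_lepP le12].
move=> [_ [m3 [m4 [M3 M4 ->]]] /mnm_lepP le34].
wlog b0m1 : m1 m2 M1 M2 le12 / (m2 b0 <= m1 b0)%N.
  move=> W; case: (leqP (m2 b0) (m1 b0)) => [|/ltnW] le; first exact: (W m1 m2).
  by apply: (W m2 m1) => // i; rewrite addmC.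
apply: NNPP => notin.
have exceeds p q : M p -> M q -> exists i, (u i < p i + q i)%N.
  move=> Mp Mq; apply: NNPP => H; apply: notin.
  exists (p + q)%MM; first by exists p, q.
  apply/mnm_lepP => i; rewrite mnmDE leqNgt; apply/negP => lt.
  by apply: H; exists i.
have {}b01 : (b0 == b1) = false by apply/eqP.
have b10 : (b1 == b0) = false by rewrite eq_sym.
have Le12 i : (m1 i + m2 i <= u i + (b0 == i))%N.
  by move: (le12 i); rewrite !mnmDE mnm1E.
have Le34 i : (m3 i + m4 i <= u i + (b1 == i))%N.
  by move: (le34 i); rewrite !mnmDE mnm1E.
(* Both products divide u up to one variable, so a variable in excess
   can only be that one. *)
have [i12 lt12] := exceeds _ _ M1 M2.
have ei12 : i12 = b0.
  by move: (Le12 i12) lt12; case: eqP => // _; lia.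
have [i34 lt34] := exceeds _ _ M3 M4.
have ei34 : i34 = b1.
  by move: (Le34 i34) lt34; case: eqP => // _; lia.
subst i12 i34.
move: (Le12 b0) (Le12 b1) (Le34 b0) (Le34 b1) (Mb _ M1) (Mb _ M2) (Mb _ M3) (Mb _ M4).
rewrite !eqxx b01 b10 => A1 A2 A3 A4 B1 B2 B3 B4.
(* By now u has degree 0 in b0 and 1 in b1, m1 has degree 1 in both, m2
   degree 0 in both, and m3, m4 have degree 0 in b0 and 1 in b1. *)
have [c ltc] := exceeds _ _ M2 M3.
have [d ltd] := exceeds _ _ M2 M4.
have cb0 : b0 != c by apply/eqP => E; subst c; lia.
have cb1 : b1 != c by apply/eqP => E; subst c; lia.
have db0 : b0 != d by apply/eqP => E; subst d; lia.
have db1 : b1 != d by apply/eqP => E; subst d; lia.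
move: (Le12 c) (Le12 d) (Le34 c) (Le34 d).
rewrite (negbTE cb0) (negbTE cb1) (negbTE db0) (negbTE db1) => C1 D1 C2 D2.
(* At c, m2 + m3 > u >= m3 + m4 and m2 + m3 > u >= m1 + m2, so m2 > m4 and
   m3 > m1; at d, similarly m2 > m3 and m4 > m1. If c = d, then
   m2 > m4 > m1 there, so m2 has the exponent 2 that is required. *)
apply: (negP (nocd c d m3 m4 m2 M3 M4 M2 _ _)).
- apply/mnm_lepP => i; rewrite mnmDE !mnm1E.
  by case: (b1 =P i) => [E|_]; case: (c =P i) => [E'|_]; subst => //=; rewrite ?eqxx in cb1 *; lia.
- apply/mnm_lepP => i; rewrite mnmDE !mnm1E.
  by case: (b1 =P i) => [E|_]; case: (d =P i) => [E'|_]; subst => //=; rewrite ?eqxx in db1 *; lia.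
- apply/mnm_lepP => i; rewrite mnmDE !mnm1E.
  by case: (c =P i) => [E|_]; case: (d =P i) => [E'|_]; subst => //=; lia.
Qed.

(** * From monomials to polynomials *)

(** Passing from [u] to [u + U_(b0)] lowers the exponent [a] that is needed and
    keeps [c], and symmetrically for [b1]; so induction on [a] and [c] puts both
    [u + U_(b0)] and [u + U_(b1)] in [P], whence [u]. *)
Lemma colon_saturation {n : nat} (P : 'X_{1..n} -> Prop) (b0 b1 : 'I_n) :
  (forall u v, P u -> (u <= v)%MM -> P v) ->
  (forall u, P (u + U_(b0))%MM -> P (u + U_(b1))%MM -> P u) ->
  forall a c u, P (u + U_(b0) *+ a)%MM -> P (u + U_(b1) *+ c)%MM -> P u.
Proof.
move=> Pup colon; elim=> [|a IHa] c u; first by rewrite mulm0n addm0.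
elim: c u => [|c IHc] u; first by rewrite mulm0n addm0.
move=> P0 P1; apply: colon.
  apply: (IHa c.+1); first by rewrite -addmA -mulmS.
  by apply: Pup P1 _; apply: lepm_add; rewrite ?lem_addr ?lepm_refl.
apply: IHc; last by rewrite -addmA -mulmS.
by apply: Pup P0 _; apply: lepm_add; rewrite ?lem_addr ?lepm_refl.
Qed.

(** The sum [b0 + b1] divides [b0 ^ N - (- b1) ^ N]. For [N] larger than the
    degree of [g], the monomial [u b0 ^ N] is not divisible by [b1 ^ N], so its
    coefficient in [(b0 ^ N - (- b1) ^ N) g] is that of [u] in [g]. *)
Lemma add_var_power_msupp {n : nat} {K : fieldType} (P : 'X_{1..n} -> Prop)
    (b0 b1 : 'I_n) (g : {mpoly K[n]}) :
  b0 <> b1 ->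
  (forall h u, u \in msupp (('X_b0 + 'X_b1) * g * h) -> P u) ->
  forall u, u \in msupp g -> P (u + U_(b0) *+ msize g)%MM.
Proof.
move=> b01 PJ u ug; set N := msize g.
apply: (PJ (\sum_(i < N) 'X_b0 ^+ (N.-1 - i) * (- 'X_b1) ^+ i)).
set D := \sum_(_ < N) _.
have DE : ('X_b0 + 'X_b1) * D = 'X_[U_(b0) *+ N] - (-1) ^+ N *: 'X_[U_(b1) *+ N].
  rewrite -['X_b1 in LHS]opprK -subrXX [in LHS]exprNn !mpolyXn.
  by rewrite -(signr_odd K) scaler_sign -signr_odd mulr_sign.
rewrite mulrAC DE mulrBl mcoeff_msupp mcoeffB mulrC addmC mcoeffMX.
rewrite -scalerAl mcoeffZ ['X_[_] * g]mulrC.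
rewrite (@memN_msupp_eq0 _ _ (g * _)) ?mulr0 ?subr0 -?mcoeff_msupp //.
rewrite (perm_mem (msuppMX _ _)); apply/negP => /mapP [v _ /mnmP /(_ b1)].
have ub1 : (u b1 < N)%N.
  apply: leq_ltn_trans (msize_mdeg_lt ug).
  by rewrite mdegE (bigD1 b1) //= leq_addr.
rewrite !mnmDE !mulmnE !mnm1E eqxx; case: eqP => // _; lia.
Qed.

Theorem theorem3p3 (K : fieldType) (n : nat) (I : {mpoly K[n]} -> Prop)
    (b0 b1 : 'I_n)
    (I_monomial : monomial_ideal I)
    (I_proper : ~ I 1)
    (b0_neq_b1 : b0 <> b1)
    (squarefree_b : forall m, min_generator I m ->
       ~~ (U_(b0) + U_(b0) <= m)%MM /\ ~~ (U_(b1) + U_(b1) <= m)%MM)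
    (b0_b1 : forall m, min_generator I m -> (U_(b0) <= m)%MM -> (U_(b1) <= m)%MM)
    (no_cd : ~ exists c d : 'I_n,
       [/\ divides_min_generator I (U_(b1) + U_(c))%MM,
           divides_min_generator I (U_(b1) + U_(d))%MM &
           divides_min_generator I (U_(c) + U_(d))%MM]) :
  regular_mod (ideal_mul I I) ('X_b0 + 'X_b1).
Proof.
have notmin0 u : above (min_generator I) u -> u <> 0%MM.
  by move=> Iu u0; apply: I_proper; rewrite -mpolyX0 -u0; apply/above_min_generator.
have bE b (m : 'X_{1..n}) : (U_(b) <= m)%MM = (0 < m b)%N.
  apply/mnm_lepP/idP => [/(_ b)|mb i]; first by rewrite mnm1E eqxx.
  by rewrite mnm1E; case: eqP => // <-.
have bbE b (m : 'X_{1..n}) : (U_(b) + U_(b) <= m)%MM = (1 < m b)%N.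
  apply/mnm_lepP/idP => [/(_ b)|mb i]; first by rewrite mnmDE mnm1E eqxx.
  by rewrite mnmDE mnm1E; case: eqP => // <-.
have Mb m : min_generator I m -> (m b0 <= m b1 <= 1)%N.
  move=> Mm; have [] := squarefree_b m Mm; have := b0_b1 m Mm.
  by rewrite !bE !bbE; lia.
pose P := above (sum_of_two (min_generator I)).
have Pup u v : P u -> (u <= v)%MM -> P v by apply: above_trans.
have colon u : P (u + U_(b0))%MM -> P (u + U_(b1))%MM -> P u.
  apply: square_colon => // c d p q r Mp Mq Mr cp dq; apply/negP => cdr.
  by apply: no_cd; exists c, d; split; [exists p | exists q | exists r].
have I2P f := ideal_mul_msupp I f I_monomial.
split=> [g /I2P fgP|].
  have mulP h u : u \in msupp (('X_b0 + 'X_b1) * g * h) -> P u.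
    by rewrite mulrC => /mem_msupp_mulr [v /fgP Pv]; apply: Pup.
  apply/I2P => u ug; apply: (colon_saturation P b0 b1 Pup colon (msize g) (msize g)).
    exact: (add_var_power_msupp P _ b1).
  apply: (add_var_power_msupp P _ b0) => // [E|h v]; first by apply: b0_neq_b1.
  by rewrite ['X_b1 + _]addrC; apply: mulP.
(* Neither I^2 nor b0 + b1 has a constant term, so all monomials in the
   support of an element of (I^2, b0 + b1) lie above a nonzero exponent. *)
move=> /(msupp_ideal_gen _ (fun m => m <> 0%MM)) H.
have [||m m0] := H _ 0%MM.
- move=> s v [/I2P sP /sP [_ [m1 [m2 [M1 _ ->]]] le]|-> vb].
    exists v; last exact: lepm_refl.
    apply: notmin0; exists m1 => //; apply: lepm_trans le; exact: lem_addr.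
  exists v; last exact: lepm_refl.
  move: vb => /msuppD_le; rewrite mem_cat !msuppX !inE => E v0.
  by case/orP: E => /eqP; rewrite v0 => /(congr1 mdeg); rewrite mdeg0 mdeg1.
- by rewrite msupp1 inE.
- by move/mnm_lepP => le; apply: m0; apply/mnmP => i; have := le i; rewrite mnm0E leqn0 => /eqP.
Qed.
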